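(* Let $[\nabla]$ be a projective structure on a surface, $U\subset N$ an open coordinate set with coordinates $(x^1,x^2)$, $\nabla\in[\nabla]$ a representative torsion-free connection with Christoffel symbols $\Gamma^k_{ij}$ and Schouten tensor $\mathrm{P}_{ij}$, and $\Lambda\neq0$ a constant. Consider on $T^*U$ (coordinates $(x^i,\xi_i)$) the metric $$g=\left(d\xi_i-\left(\Gamma_{ij}^k \xi_k-\Lambda \xi_i\xi_j- \Lambda^{-1}\mathrm{P}_{ji}\right)dx^j\right)\odot dx^i$$ and the $2$-form $\Omega= d\xi_i\wedge dx^i+\frac{1}{\Lambda}\mathrm{P}_{ij}\, dx^i\wedge dx^j$. If $K=K^i\partial/\partial x^i$ is a projective vector field on $U$, i.e. $\mathcal{L}_K\Gamma^k_{ij}=\delta_i^k\rho_j+\delta_j^k\rho_i$ for some $1$-form $\rho$, then $$\mathcal{K}:=K-\xi_j\frac{\partial K^j}{\partial x^i}\frac{\partial}{\partial \xi_i}+\frac{1}{\Lambda}\rho_i\frac{\partial}{\partial \xi_i}$$ is a Killing vector field of $g$ satisfying $\mathcal{L}_{\mathcal K}\Omega=0$. Conversely, every Killing vector field of $g$ is of the form $\mathcal{K}$ for some projective vector field $K$ on $U$.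
   Context: A projective structure is an equivalence class of torsion-free connections with the same unparametrised geodesics. Here $\mathcal{L}_K\Gamma^k_{ij}\equiv \frac{\partial^2 K^k}{\partial x^i \partial x^j}+K^m\frac{\partial}{\partial x^m} \Gamma_{ij}^k- \Gamma_{ij}^m\frac{\partial K^k}{\partial x^m}+\Gamma_{im}^k\frac{\partial K^m}{\partial x^j}+\Gamma_{jm}^k\frac{\partial K^m}{\partial x^i}$. The curvature is $[\nabla_i,\nabla_j]X^k=R_{ij}{}^k{}_lX^l$ and the (not necessarily symmetric) Schouten tensor is defined by $R_{ij}{}^k{}_l=\delta_i{}^k\mathrm{P}_{jl}-\delta_j{}^k\mathrm{P}_{il}-2\mathrm{P}_{[ij]}\delta_l{}^k$. Indices run over $1,2$ with summation convention; $\odot$ is the symmetric tensor product. *)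

(* Defs.v *)
From HB Require Import structures.
From mathcomp Require Import all_boot all_order all_algebra.
From mathcomp Require Import all_classical all_reals all_analysis.
Set Implicit Arguments. Unset Strict Implicit. Unset Printing Implicit Defensive.
Import Order.TTheory GRing.Theory Num.Theory.
Import numFieldNormedType.Exports.
Local Open Scope classical_set_scope.
Local Open Scope ring_scope.

Section Defs.
Variable R : realType.

Definition partial n (i : 'I_n) (f : 'rV[R]_n -> R) : 'rV[R]_n -> R :=
  fun x => derive f x (delta_mx 0 i).

Definition iter_partial n (s : seq 'I_n) (f : 'rV[R]_n -> R) : 'rV[R]_n -> R :=
  foldr (fun i g => partial i g) f s.

Definition smooth_on n (A : set 'rV[R]_n) (f : 'rV[R]_n -> R) : Prop :=
  forall (s : seq 'I_n) (x : 'rV[R]_n), A x -> differentiable (iter_partial s f) x.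

Definition kdelta n (i j : 'I_n) : R := (i == j)%:R.

(* Curvature of the torsion-free connection with Christoffel symbols
   Gam k i j = Gamma^k_{ij}, with [nabla_i, nabla_j] X^k = R_{ij}^k_l X^l :
   R_{ij}^k_l = d_i Gam^k_{jl} - d_j Gam^k_{il}
                + Gam^k_{im} Gam^m_{jl} - Gam^k_{jm} Gam^m_{il}. *)
Definition curvature (Gam : 'I_2 -> 'I_2 -> 'I_2 -> 'rV[R]_2 -> R)
  (i j k l : 'I_2) (x : 'rV[R]_2) : R :=
  partial i (Gam k j l) x - partial j (Gam k i l) x
  + \sum_(m < 2) (Gam k i m x * Gam m j l x - Gam k j m x * Gam m i l x).

Definition is_schouten (U : set 'rV[R]_2)
  (Gam : 'I_2 -> 'I_2 -> 'I_2 -> 'rV[R]_2 -> R) (P : 'I_2 -> 'I_2 -> 'rV[R]_2 -> R) :=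
  forall (i j k l : 'I_2) (x : 'rV[R]_2), U x ->
    curvature Gam i j k l x =
      kdelta i k * P j l x - kdelta j k * P i l x - (P i j x - P j i x) * kdelta l k.

Definition lieGam (K : 'I_2 -> 'rV[R]_2 -> R)
  (Gam : 'I_2 -> 'I_2 -> 'I_2 -> 'rV[R]_2 -> R) (k i j : 'I_2) (x : 'rV[R]_2) : R :=
  partial i (partial j (K k)) x
  + \sum_(m < 2) K m x * partial m (Gam k i j) x
  - \sum_(m < 2) Gam m i j x * partial m (K k) x
  + \sum_(m < 2) Gam k i m x * partial j (K m) x
  + \sum_(m < 2) Gam k j m x * partial i (K m) x.

Definition projective_vf (U : set 'rV[R]_2)
  (Gam : 'I_2 -> 'I_2 -> 'I_2 -> 'rV[R]_2 -> R)
  (K : 'I_2 -> 'rV[R]_2 -> R) (rho : 'I_2 -> 'rV[R]_2 -> R) : Prop :=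
  (forall k, smooth_on U (K k)) /\
  forall (k i j : 'I_2) (x : 'rV[R]_2), U x ->
    lieGam K Gam k i j x = kdelta i k * rho j x + kdelta j k * rho i x.

(* Cotangent bundle coordinates on T*U = U x R^2: y = (x^1, x^2, xi_1, xi_2),
   index lshift 2 i <-> x^i, rshift 2 i <-> xi_i. *)
Definition xpart (y : 'rV[R]_(2 + 2)) : 'rV[R]_2 := \row_i y 0 (lshift 2 i).
Definition xipart (y : 'rV[R]_(2 + 2)) (i : 'I_2) : R := y 0 (rshift 2 i).
Definition cotU (U : set 'rV[R]_2) : set 'rV[R]_(2 + 2) := fun y => U (xpart y).

Definition dx (i : 'I_2) (a : 'I_(2 + 2)) : R := (a == lshift 2 i)%:R.
Definition dxi (i : 'I_2) (a : 'I_(2 + 2)) : R := (a == rshift 2 i)%:R.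

Definition symprod (al be : 'I_(2 + 2) -> R) (a b : 'I_(2 + 2)) : R :=
  (al a * be b + be a * al b) / 2.
Definition wedge (al be : 'I_(2 + 2) -> R) (a b : 'I_(2 + 2)) : R :=
  al a * be b - be a * al b.

Definition coefA (Gam : 'I_2 -> 'I_2 -> 'I_2 -> 'rV[R]_2 -> R)
  (P : 'I_2 -> 'I_2 -> 'rV[R]_2 -> R) (Lam : R) (i j : 'I_2) (y : 'rV[R]_(2 + 2)) : R :=
  \sum_(k < 2) Gam k i j (xpart y) * xipart y k
  - Lam * xipart y i * xipart y j - Lam^-1 * P j i (xpart y).

Definition metric_g (Gam : 'I_2 -> 'I_2 -> 'I_2 -> 'rV[R]_2 -> R)
  (P : 'I_2 -> 'I_2 -> 'rV[R]_2 -> R) (Lam : R)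
  (y : 'rV[R]_(2 + 2)) (a b : 'I_(2 + 2)) : R :=
  \sum_(i < 2) symprod (fun c => dxi i c - \sum_(j < 2) coefA Gam P Lam i j y * dx j c)
                        (dx i) a b.

Definition omega (P : 'I_2 -> 'I_2 -> 'rV[R]_2 -> R) (Lam : R)
  (y : 'rV[R]_(2 + 2)) (a b : 'I_(2 + 2)) : R :=
  \sum_(i < 2) wedge (dxi i) (dx i) a b
  + Lam^-1 * \sum_(i < 2) \sum_(j < 2) P i j (xpart y) * wedge (dx i) (dx j) a b.

Definition lie2 (X : 'I_(2 + 2) -> 'rV[R]_(2 + 2) -> R)
  (T : 'rV[R]_(2 + 2) -> 'I_(2 + 2) -> 'I_(2 + 2) -> R)
  (y : 'rV[R]_(2 + 2)) (a b : 'I_(2 + 2)) : R :=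
  \sum_(c < 2 + 2) X c y * partial c (fun z => T z a b) y
  + \sum_(c < 2 + 2) T y c b * partial a (X c) y
  + \sum_(c < 2 + 2) T y a c * partial b (X c) y.

Definition killing (A : set 'rV[R]_(2 + 2))
  (T : 'rV[R]_(2 + 2) -> 'I_(2 + 2) -> 'I_(2 + 2) -> R)
  (X : 'I_(2 + 2) -> 'rV[R]_(2 + 2) -> R) : Prop :=
  (forall a, smooth_on A (X a)) /\
  forall y, A y -> forall a b, lie2 X T y a b = 0.

Definition cot_lift (K : 'I_2 -> 'rV[R]_2 -> R) (rho : 'I_2 -> 'rV[R]_2 -> R) (Lam : R)
  (a : 'I_(2 + 2)) (y : 'rV[R]_(2 + 2)) : R :=
  match fintype.split a with
  | inl i => K i (xpart y)
  | inr i => - \sum_(j < 2) xipart y j * partial i (K j) (xpart y)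
             + Lam^-1 * rho i (xpart y)
  end.

End Defs.

(* Main.v *)
Require Import Defs.
From HB Require Import structures.
From mathcomp Require Import all_boot all_order all_algebra.
From mathcomp Require Import all_classical all_reals all_analysis.
From mathcomp Require Import ring lra.
Import Order.TTheory GRing.Theory Num.Theory.
Import numFieldNormedType.Exports.
Local Open Scope classical_set_scope.
Local Open Scope ring_scope.

(* For the lift of a pair (K, rho), the fibre-fibre and mixed components of the
   Lie derivative of g vanish identically, and its base components are affine in
   xi: the linear part is L_K Gamma^k_{ij} - delta_i^k rho_j - delta_j^k rho_i, the
   constant part is the symmetrisation of L_K P_{ij} + nabla_i rho_j. On a surface
   P_{ij} = (2 Ric_{ij} + Ric_{ji}) / 3, so the Palatini identity for the variation
   L_K Gamma turns the projective equation into L_K P_{ij} = - nabla_i rho_j; its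
   antisymmetric part is the invariance of Omega.

   Conversely, let X be a Killing field. The fibre-fibre equations give
   X^i = K^i(x) + b(x) eps^{ij} xi_j. The integrability condition in xi of the mixed
   equations is d_j b + b (Gamma^k_{kj} - 3 Lambda xi_j) = 0, whose xi_j-derivative is
   -3 Lambda b = 0. Hence X^i = K^i(x), the mixed equations make the xi-components
   affine on the fibres, so X is the lift of some (K, rho), and the part linear in xi
   of the base equations says that K is projective. *)

Set Implicit Arguments. Unset Strict Implicit. Unset Printing Implicit Defensive.

(** * Directional derivatives and Young's theorem *)

Section DirectionalDerivatives.
Variables (R : realType) (V W : normedModType R).

(** Both difference quotients are the same function of [h], so nothing is required of [f] or [phi]
    away from the line through [y]. *)
Lemma derive_comp_affine (V' : normedModType R) (f : V -> W) (phi : V' -> V)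
    (y w : V') (v : V) :
  (forall h : R, phi (h *: w + y) = h *: v + phi y) ->
  'D_w (fun z => f (phi z)) y = 'D_v f (phi y) /\
  (derivable f (phi y) v -> derivable (fun z => f (phi z)) y w).
Proof.
move=> phiE.
have E : (fun h : R => h^-1 *: (((fun z => f (phi z)) \o shift y) (h *: w)
                               - f (phi y)))
       = (fun h : R => h^-1 *: ((f \o shift (phi y)) (h *: v) - f (phi y))).
  by apply/funext => h /=; rewrite phiE.
by split; rewrite /derivable /derive E.
Qed.

Lemma is_derive_comp_affine (V' : normedModType R) (f : V -> W) (phi : V' -> V)
    (y w : V') (v : V) (d : W) :
  (forall h : R, phi (h *: w + y) = h *: v + phi y) ->
  is_derive (phi y) v f d -> is_derive y w (fun z => f (phi z)) d.
Proof.
move=> /(derive_comp_affine f) [E D] [dvf dE].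
by split; [exact: D | rewrite E].
Qed.

Lemma near_eq_differentiable (f g : V -> W) (x : V) :
  (\forall y \near x, f y = g y) -> differentiable f x -> differentiable g x.
Proof.
move=> fg df.
have E : g \o shift x = cst (g x) + 'd f x +o_ 0 id.
  apply/eqaddoP => e e0; have /diff_locally/eqaddoP/(_ _ e0) := df.
  have fg0 : \forall h \near (0 : V), f (h + x) = g (h + x).
    by move: fg; rewrite (near_shift 0) /= subr0.
  apply: filterS2 fg0 => h /=.
  by rewrite !fctE /= => ->; rewrite (nbhs_singleton fg).
have dE : 'd g x = 'd f x :> (V -> W) by apply: diff_unique E; exact: diff_continuous.
by apply/diff_locallyP; rewrite dE; split => //; exact: diff_continuous.
Qed.

End DirectionalDerivatives.

Section Young.
Variables (R : realType) (V : normedModType R).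

(** The second difference is symmetric in [u] and [v]. Exchanging them makes the same quantity
    approximate both mixed derivatives, which is how [derive_commute] uses this estimate. *)
Lemma second_difference_estimate (f : V -> R) (x u v : V) :
  (\forall y \near x, differentiable f y) ->
  differentiable (fun y => 'D_u f y) x ->
  forall e : R, 0 < e -> \forall h \near (0 : R)^'+,
    `|f (x + h *: u + h *: v) - f (x + h *: u) - f (x + h *: v) + f x
      - h ^+ 2 * 'D_v (fun y => 'D_u f y) x| <= e * h ^+ 2.
Proof.
move=> df dDf e e0.
pose G := fun y => 'D_u f y.
(* The two expansion errors add up to at most h^2 times (e / M) 2(|u| + |v|), which [M] keeps below
   e h^2. The added 1 makes [M] positive even when u = v = 0. *)
pose M := (`|u| + `|v|) *+ 2 + 1.
have M0 : 0 < M by rewrite ltr_pwDr// mulrn_wge0// addr_ge0.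
have e'0 : 0 < e / M by rewrite divr_gt0.
have /diff_locally/eqaddoP/(_ _ e'0) := dDf.
rewrite /= => nearG.
have [r1 /= r10 Hr1] := (nbhs_ballP _ _).1 df.
have [r2 /= r20 Hr2] := (nbhs_ballP _ _).1 nearG.
pose r := Num.min r1 r2.
have r0 : 0 < r by rewrite lt_min r10.
near=> h.
have h0 : 0 < h by near: h; exact: nbhs_right_gt.
have hr : h * M < r.
  by rewrite -ltr_pdivlMr//; near: h; apply: nbhs_right_lt; rewrite divr_gt0.
have nrm (a b : R) : 0 <= a <= h -> 0 <= b <= h ->
    `|a *: u + b *: v| <= h * (`|u| + `|v|).
  move=> /andP[a0 ah] /andP[b0 bh].
  rewrite (le_trans (ler_normD _ _))// !normrZ !ger0_norm// mulrDr.
  by rewrite lerD// ler_wpM2r.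
have nrmr (a b : R) : 0 <= a <= h -> 0 <= b <= h -> `|a *: u + b *: v| < r.
  move=> aP bP; rewrite (le_lt_trans (nrm _ _ aP bP))// (le_lt_trans _ hr)//.
  rewrite ler_pM2l// /M; have := normr_ge0 u; have := normr_ge0 v; lra.
have dfab (a b : R) : 0 <= a <= h -> 0 <= b <= h ->
    differentiable f (x + (a *: u + b *: v)).
  move=> aP bP; apply: Hr1; rewrite -ball_normE/= opprD addNKr normrN.
  by rewrite (lt_le_trans (nrmr _ _ aP bP))// /r ge_min lexx.
have Gab (a b : R) : 0 <= a <= h -> 0 <= b <= h ->
    `|G (a *: u + b *: v + x) - (G x + 'd G x (a *: u + b *: v))|
      <= e / M * (h * (`|u| + `|v|)).
  move=> aP bP.
  have : ball (0 : V) r2 (a *: u + b *: v).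
    rewrite -ball_normE/= sub0r normrN.
    by rewrite (lt_le_trans (nrmr _ _ aP bP))// /r ge_min lexx orbT.
  move=> /Hr2 /=; rewrite !fctE /= => /le_trans; apply.
  by rewrite ler_wpM2l ?(ltW e'0)// nrm.
have hh : 0 <= h <= h by rewrite lexx ltW.
have zh : 0 <= (0 : R) <= h by rewrite lexx ltW.
pose phi (t : R) := f (x + (t *: u + h *: v)) - f (x + (t *: u + 0 *: v)).
pose dphi (t : R) := G (x + (t *: u + h *: v)) - G (x + (t *: u + 0 *: v)).
(* The second difference is [phi h - phi 0], and the mean value theorem applied to
   [phi] only needs the first-order expansion of ['D_u f] at [x]. *)
have Dphi (t : R) : 0 <= t <= h -> is_derive t 1 phi (dphi t).
  move=> tP.
  have L b : 0 <= b <= h -> is_derive t 1 (fun s : R => f (x + (s *: u + b *: v)))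
       (G (x + (t *: u + b *: v))).
    move=> bP.
    apply: (@is_derive_comp_affine _ _ _ _ f (fun s : R => x + (s *: u + b *: v))
              _ _ u).
      by move=> k; rewrite scalerDl [k%:A]mulr1 -[_ + _ + b *: v]addrA [LHS]addrCA.
    by apply/derivableP/diff_derivable/dfab.
  by apply: is_deriveB; exact: L.
have [c /= ch Ec] : exists2 c, c \in `]0, h[%R & phi h - phi 0 = dphi c * (h - 0).
  apply: MVT => //.
    by move=> t /itvP tP; apply: Dphi; rewrite !tP.
  apply: derivable_within_continuous => t /itvP tP.
  by have [] : is_derive t 1 phi (dphi t) by apply: Dphi; rewrite !tP.
have cP : 0 <= c <= h by move/itvP: ch => ch; rewrite !ch.
have -> : f (x + h *: u + h *: v) - f (x + h *: u) - f (x + h *: v) + f x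
        = phi h - phi 0.
  rewrite /phi !scale0r !addr0 !add0r addrA; ring.
rewrite Ec subr0 -/G deriveE//.
set du := 'd G x u; set dv := 'd G x v.
have lin (a b : R) : 'd G x (a *: u + b *: v) = a * du + b * dv.
  by rewrite linearD !linearZ.
have := Gab c h cP hh; have := Gab c 0 cP zh.
rewrite /dphi !lin mul0r addr0 ![_ + x]addrC.
set g1 := G (x + (c *: u + 0 *: v)); set g2 := G (x + _) => A1 A2.
have -> : (g2 - g1) * h - h ^+ 2 * dv =
   h * ((g2 - (G x + (c * du + h * dv))) - (g1 - (G x + c * du))) by ring.
rewrite normrM gtr0_norm// expr2 mulrCA ler_pM2l//.
apply: (le_trans (ler_normB _ _)); apply: le_trans (lerD A2 A1) _.
have -> : e / M * (h * (`|u| + `|v|)) + e / M * (h * (`|u| + `|v|))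
        = h * (e / M * ((`|u| + `|v|) *+ 2)) by ring.
rewrite [leRHS]mulrC ler_pM2l// -[leRHS](divfK (lt0r_neq0 M0)).
by rewrite ler_wpM2l ?(ltW e'0)// /M lerDl.
Unshelve. all: by end_near. Qed.

Lemma common_approximation (F a b e k : R) : 0 < k ->
  `|F - k * a| <= e / 2 * k -> `|F - k * b| <= e / 2 * k -> `|a - b| <= e.
Proof.
move=> k0 A B; rewrite -(ler_pM2l k0) -[X in X * _](gtr0_norm k0) -normrM.
have -> : k * (a - b) = (F - k * b) - (F - k * a) by ring.
have -> : k * e = e / 2 * k + e / 2 * k by field.
by rewrite (le_trans (ler_normB _ _)) ?lerD.
Qed.

Lemma derive_commute (f : V -> R) (x u v : V) :
  (\forall y \near x, differentiable f y) ->
  differentiable (fun y => 'D_u f y) x -> differentiable (fun y => 'D_v f y) x ->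
  'D_v (fun y => 'D_u f y) x = 'D_u (fun y => 'D_v f y) x.
Proof.
move=> df du dv; apply/eqP; rewrite -subr_eq0 -normr_eq0 eq_le normr_ge0 andbT.
apply/ler_addgt0Pl => e e0; rewrite addr0.
have e20 : 0 < e / 2 by rewrite divr_gt0.
have nA := second_difference_estimate v df du e20.
have nB := second_difference_estimate u df dv e20.
have [h [[A B] h0]] := @filter_ex _ _ (@at_right_proper_filter R 0) _
  (filterI (filterI nA nB) (nbhs_right_gt 0)).
rewrite [x + h *: v + h *: u]addrAC [_ - f (x + h *: v) - _]addrAC in B.
have h20 : 0 < h ^+ 2 by rewrite exprn_gt0.
exact: common_approximation h20 A B.
Qed.

End Young.

(** * Smooth functions of several variables *)

Section SmoothFunctions.
Variables (R : realType) (n : nat).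
Implicit Types (A : set 'rV[R]_n) (f g : 'rV[R]_n -> R).

(** A form of [smooth_on] suited to induction. It peels off the derivative that is applied first,
    whereas [iter_partial] exposes the one applied last. *)
Fixpoint differentiable_upto k A f : Prop :=
  (forall x, A x -> differentiable f x) /\
  if k is k'.+1 then forall i, differentiable_upto k' A (partial i f) else True.

Lemma differentiable_upto_differentiable k A f x :
  differentiable_upto k A f -> A x -> differentiable f x.
Proof. by case: k => [|k] [+ _] => /[apply]. Qed.

Lemma smooth_on_differentiable A f x : smooth_on A f -> A x -> differentiable f x.
Proof. by move=> /(_ [::] x); apply. Qed.

Lemma smooth_on_partial A f i : smooth_on A f -> smooth_on A (partial i f).
Proof.
by move=> sf s x Ax; have := sf (rcons s i) x Ax; rewrite /iter_partial foldr_rcons.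
Qed.

Lemma smooth_onP A f : smooth_on A f <-> forall k, differentiable_upto k A f.
Proof.
split=> [sf k|].
  elim: k f sf => [|k IH] f sf; split => //.
  - by move=> x; exact: smooth_on_differentiable.
  - by move=> x; exact: smooth_on_differentiable.
  - by move=> i; apply: IH; exact: smooth_on_partial.
move=> df s; elim/last_ind: s f df => [|s i IH] f df x Ax.
  exact: (differentiable_upto_differentiable (df 0)).
rewrite /iter_partial foldr_rcons; apply: IH Ax => k.
by have [_ +] := df k.+1; apply.
Qed.

Lemma near_open A f g x : open A -> (forall y, A y -> f y = g y) -> A x ->
  \forall y \near x, f y = g y.
Proof. by move=> oA fg Ax; apply: filterS (open_nbhs_nbhs (conj oA Ax)). Qed.

Lemma partial_eq_on A f g i x :
  open A -> (forall y, A y -> f y = g y) -> A x -> partial i f x = partial i g x.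
Proof. by move=> oA fg Ax; apply/near_eq_derive/(near_open oA fg Ax). Qed.

Lemma differentiable_upto_eq_on k A f g : open A -> (forall y, A y -> f y = g y) ->
  differentiable_upto k A f -> differentiable_upto k A g.
Proof.
move=> oA; elim: k f g => [|k IH] f g fg [df dfk]; split => //.
- by move=> x Ax; apply: near_eq_differentiable (near_open oA fg Ax) (df _ Ax).
- by move=> x Ax; apply: near_eq_differentiable (near_open oA fg Ax) (df _ Ax).
- by move=> i; apply: IH (dfk i) => y Ay; apply: partial_eq_on oA fg Ay.
Qed.

Lemma smooth_on_eq A f g : open A -> (forall y, A y -> f y = g y) ->
  smooth_on A f -> smooth_on A g.
Proof.
move=> oA fg /smooth_onP sf; apply/smooth_onP => k.
exact: differentiable_upto_eq_on (sf k).
Qed.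

(* Unlike [is_derive], not a type class: resolution would otherwise rewrite
   products of real functions into scalings. *)
Definition has_partial i f x (d : R) : Prop := is_derive x (delta_mx 0 i) f d.

Lemma differentiable_has_partial f x i :
  differentiable f x -> has_partial i f x (partial i f x).
Proof. by move=> df; apply/derivableP/diff_derivable. Qed.

Lemma smooth_on_has_partial A f x i : smooth_on A f -> A x ->
  has_partial i f x (partial i f x).
Proof. by move=> sf Ax; apply/differentiable_has_partial/smooth_on_differentiable/Ax. Qed.

Lemma partial_val f x i (d : R) : has_partial i f x d -> partial i f x = d.
Proof. by case. Qed.

Lemma has_partial_eq f x i (a b : R) : has_partial i f x a -> a = b -> has_partial i f x b.
Proof. by move=> ? <-. Qed.

Lemma has_partial_cst (c : R) x i : has_partial i (fun=> c) x 0.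
Proof. exact: is_derive_cst. Qed.

Lemma has_partialD f g x i (a b : R) : has_partial i f x a -> has_partial i g x b ->
  has_partial i (fun y => f y + g y) x (a + b).
Proof. by move=> *; exact: is_deriveD. Qed.

Lemma has_partialN f x i (a : R) : has_partial i f x a ->
  has_partial i (fun y => - f y) x (- a).
Proof. by move=> *; exact: is_deriveN. Qed.

Lemma has_partialM f g x i (a b : R) : has_partial i f x a -> has_partial i g x b ->
  has_partial i (fun y => f y * g y) x (f x * b + g x * a).
Proof. by move=> *; exact: is_deriveM. Qed.

Lemma has_partial_sum m (F : 'I_m -> 'rV[R]_n -> R) x i (a : 'I_m -> R) :
  (forall j, has_partial i (F j) x (a j)) ->
  has_partial i (fun y => \sum_(j < m) F j y) x (\sum_(j < m) a j).
Proof.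
move=> dF; rewrite (_ : (fun y => _) = \sum_(j < m) F j); first exact: is_derive_sum.
by apply/funext => y; rewrite fct_sumE.
Qed.

Lemma differentiable_upto_cst k A (c : R) : differentiable_upto k A (fun=> c).
Proof.
elim: k c => [|k IH] c; split=> //; try by move=> x _; exact: differentiable_cst.
move=> i; rewrite (_ : partial i _ = fun=> 0)//.
by apply/funext => x; apply: partial_val; exact: has_partial_cst.
Qed.

Lemma differentiable_uptoD k A f g : open A ->
  differentiable_upto k A f -> differentiable_upto k A g ->
  differentiable_upto k A (fun x => f x + g x).
Proof.
move=> oA; elim: k f g => [|k IH] f g [df dfk] [dg dgk]; split=> //;
  try by move=> x Ax; apply: differentiableD; [exact: df | exact: dg].
move=> i; apply: differentiable_upto_eq_on (IH _ _ (dfk i) (dgk i)) => // x Ax.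
by apply/esym/partial_val/has_partialD; apply: differentiable_has_partial; [exact: df|exact: dg].
Qed.

Lemma differentiable_uptoS k A f : differentiable_upto k.+1 A f -> differentiable_upto k A f.
Proof.
by elim: k f => [|k IH] f [df dfk]; split => // i; apply: IH; exact: dfk.
Qed.

Lemma differentiable_uptoM k A f g : open A ->
  differentiable_upto k A f -> differentiable_upto k A g ->
  differentiable_upto k A (fun x => f x * g x).
Proof.
move=> oA; elim: k f g => [|k IH] f g [df dfk] [dg dgk]; split=> //;
  try by move=> x Ax; apply: differentiableM; [exact: df | exact: dg].
(* Each term of the Leibniz rule keeps one factor undifferentiated, so the hypotheses on [f] and [g]
   are also needed at the lower order. *)
move=> i; have fk : differentiable_upto k A f by exact: (@differentiable_uptoS k A f).
have gk : differentiable_upto k A g by exact: (@differentiable_uptoS k A g).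
apply: differentiable_upto_eq_on
  (differentiable_uptoD oA (IH _ _ fk (dgk i)) (IH _ _ gk (dfk i))) => // x Ax.
by apply/esym/partial_val/has_partialM; apply: differentiable_has_partial; [exact: df|exact: dg].
Qed.

Lemma smooth_on_cst A (c : R) : smooth_on A (fun=> c).
Proof. by apply/smooth_onP => k; exact: differentiable_upto_cst. Qed.

Lemma smooth_onD A f g : open A -> smooth_on A f -> smooth_on A g ->
  smooth_on A (fun x => f x + g x).
Proof.
by move=> oA /smooth_onP sf /smooth_onP sg; apply/smooth_onP => k; exact: differentiable_uptoD.
Qed.

Lemma smooth_onM A f g : open A -> smooth_on A f -> smooth_on A g ->
  smooth_on A (fun x => f x * g x).
Proof.
by move=> oA /smooth_onP sf /smooth_onP sg; apply/smooth_onP => k; exact: differentiable_uptoM.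
Qed.

Lemma smooth_onN A f : open A -> smooth_on A f -> smooth_on A (fun x => - f x).
Proof.
move=> oA sf; rewrite (_ : (fun x => _) = fun x => (-1) * f x).
  by apply: smooth_onM => //; exact: smooth_on_cst.
by apply/funext => x; rewrite mulN1r.
Qed.

Lemma smooth_on_sum A m (F : 'I_m -> 'rV[R]_n -> R) :
  open A -> (forall i, smooth_on A (F i)) ->
  smooth_on A (fun x => \sum_(i < m) F i x).
Proof.
move=> oA; elim: m F => [|m IH] F sF.
  by under eq_fun do rewrite big_ord0; exact: smooth_on_cst.
under eq_fun do rewrite big_ord_recl; apply: smooth_onD => //.
by apply: IH => i; exact: sF.
Qed.

Lemma partial_commute A f i j x : open A -> smooth_on A f -> A x ->
  partial i (partial j f) x = partial j (partial i f) x.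
Proof.
move=> oA sf Ax; apply: derive_commute.
- have : \forall y \near x, A y by exact: open_nbhs_nbhs.
  by apply: filterS => y; exact: smooth_on_differentiable.
- exact: smooth_on_differentiable (smooth_on_partial j sf) Ax.
- exact: smooth_on_differentiable (smooth_on_partial i sf) Ax.
Qed.

Lemma has_partial_coord (i j : 'I_n) (x : 'rV[R]_n) :
  has_partial j (fun y : 'rV[R]_n => y 0 i) x (j == i)%:R.
Proof.
apply: (@is_derive_comp_affine _ _ _ _ id (fun y : 'rV[R]_n => y 0 i) _ _ (j == i)%:R).
by move=> h; rewrite !mxE eqxx /= eq_sym.
Qed.

Lemma smooth_on_coord A (i : 'I_n) : smooth_on A (fun x => x 0 i).
Proof.
apply/smooth_onP => -[|k]; split=> //; try by move=> x _; exact: differentiable_coord.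
move=> j; rewrite (_ : partial j _ = fun=> (j == i)%:R); first exact: differentiable_upto_cst.
by apply/funext => x; apply: partial_val; exact: has_partial_coord.
Qed.

Lemma constant_along_line f x v :
  (forall t : R, is_derive (x + t *: v) v f 0) -> forall t, f (x + t *: v) = f x.
Proof.
move=> dF t; rewrite -[in RHS](addr0 x) -(scale0r v).
apply: (@is_derive_0_is_cst _ (fun s : R => f (x + s *: v))) => s.
apply: (@is_derive_comp_affine _ _ _ _ f (fun s : R => x + s *: v) _ _ v) => // h.
by rewrite scalerDl [h%:A]mulr1 addrCA.
Qed.

End SmoothFunctions.

(** * Composition with maps sending each coordinate direction to a coordinate direction or to
    zero *)

Section Substitution.
Variables (R : realType) (m n : nat) (phi : 'rV[R]_m -> 'rV[R]_n).
Variable s : 'I_m -> option 'I_n.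
Hypothesis phi_diff : forall y, differentiable phi y.
Hypothesis phi_shift : forall i (h : R) y, phi (h *: delta_mx 0 i + y) =
  h *: (if s i is Some j then delta_mx 0 j else 0) + phi y.

Lemma partial_subst f i y : partial i (fun z => f (phi z)) y =
  if s i is Some j then partial j f (phi y) else 0.
Proof.
apply: etrans (derive_comp_affine f (fun h => phi_shift i h y)).1 _.
by case: (s i) => [j//|]; rewrite derive0.
Qed.

Lemma smooth_on_subst (A : set 'rV[R]_n) f :
  smooth_on A f -> smooth_on [set y | A (phi y)] (fun z => f (phi z)).
Proof.
move=> /smooth_onP sf; apply/smooth_onP => k; move: (sf k); clear sf.
elim: k f => [|k IH] f [df dfk]; split=> //;
  try by move=> y Ay; apply: (@differentiable_comp _ _ _ _ phi f) => //; exact: df.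
move=> i; rewrite (_ : partial i _ = fun y =>
    if s i is Some j then partial j f (phi y) else 0); last first.
  by apply/funext => y; rewrite partial_subst.
by case: (s i) => [j|]; [exact: IH (dfk j) | exact: differentiable_upto_cst].
Qed.

End Substitution.

(** * The Palatini identity *)

(** These spellings of the two indices are the ones [big_ord_recl] produces, so expanded sums and
    case analyses share their atoms. *)
Local Notation i0 := (@ord0 1).
Local Notation i1 := (lift (@ord0 1) (@ord0 0)).

Lemma ord2_ind (Q : 'I_2 -> Prop) : Q i0 -> Q i1 -> forall i, Q i.
Proof.
move=> Q0 Q1 [[|[|//]] p].
  by rewrite (_ : Ordinal p = i0)//; exact: val_inj.
by rewrite (_ : Ordinal p = i1)//; exact: val_inj.
Qed.

Lemma sum_ord2 (V : nmodType) (F : 'I_2 -> V) : \sum_(i < 2) F i = F i0 + F i1.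
Proof. by rewrite !big_ord_recl big_ord0 addr0. Qed.

Lemma ord22_ind (Q : 'I_(2 + 2) -> Prop) :
  (forall i, Q (lshift 2 i)) -> (forall i, Q (rshift 2 i)) -> forall a, Q a.
Proof. by move=> Ql Qr a; case: (split_ordP a) => i ->. Qed.

Lemma sum_ord22 (V : nmodType) (F : 'I_(2 + 2) -> V) :
  \sum_(c < 2 + 2) F c =
  F (lshift 2 i0) + F (lshift 2 i1) + (F (rshift 2 i0) + F (rshift 2 i1)).
Proof. by rewrite big_split_ord !sum_ord2. Qed.

(* The jets at a point of a connection and a vector field:
   [dG m k i j] is the m-th partial derivative of [Gamma^k_{ij}], and [dK i k],
   [ddK i j k], [dddK i j l k] those of [K^k]; the differentiation indices come
   first. *)
Section JetIdentity.
Variable F : fieldType.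
Variables (G : 'I_2 -> 'I_2 -> 'I_2 -> F) (dG : 'I_2 -> 'I_2 -> 'I_2 -> 'I_2 -> F).
Variable ddG : 'I_2 -> 'I_2 -> 'I_2 -> 'I_2 -> 'I_2 -> F.
Variables (K : 'I_2 -> F) (dK : 'I_2 -> 'I_2 -> F) (ddK : 'I_2 -> 'I_2 -> 'I_2 -> F).
Variable dddK : 'I_2 -> 'I_2 -> 'I_2 -> 'I_2 -> F.
Hypothesis G_sym : forall k i j, G k i j = G k j i.
Hypothesis dG_sym : forall m k i j, dG m k i j = dG m k j i.
Hypothesis ddG_sym : forall n m k i j, ddG n m k i j = ddG n m k j i.
Hypothesis ddG_comm : forall n m k i j, ddG n m k i j = ddG m n k i j.
Hypothesis ddK_comm : forall i j k, ddK i j k = ddK j i k.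
Hypothesis dddK_comm : forall i j k l, dddK i j k l = dddK j i k l.
Hypothesis dddK_comm' : forall i j k l, dddK i j k l = dddK i k j l.

(** The Ricci tensor is the contraction R_{kj}^k_l; it need not be symmetric. *)
Definition jet_ricci j l : F := \sum_(k < 2)
  (dG k k j l - dG j k k l + \sum_(m < 2) (G k k m * G m j l - G k j m * G m k l)).

Definition jet_dricci n j l : F := \sum_(k < 2)
  (ddG n k k j l - ddG n j k k l
   + \sum_(m < 2) (G k k m * dG n m j l + dG n k k m * G m j l
                   - (G k j m * dG n m k l + dG n k j m * G m k l))).

Definition jet_lie_ricci j l : F :=
  \sum_(m < 2) K m * jet_dricci m j l
  + \sum_(m < 2) (jet_ricci m l * dK j m + jet_ricci j m * dK l m).

Definition jet_lie k i j : F :=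
  ddK i j k + \sum_(m < 2) K m * dG m k i j - \sum_(m < 2) G m i j * dK m k
  + \sum_(m < 2) G k i m * dK j m + \sum_(m < 2) G k j m * dK i m.

Definition jet_dlie n k i j : F :=
  dddK n i j k + \sum_(m < 2) (K m * ddG n m k i j + dK n m * dG m k i j)
  - \sum_(m < 2) (G m i j * ddK n m k + dG n m i j * dK m k)
  + \sum_(m < 2) (G k i m * ddK n j m + dG n k i m * dK j m)
  + \sum_(m < 2) (G k j m * ddK n i m + dG n k j m * dK i m).

(** The covariant derivative of [L_K Gamma], which is a tensor although Gamma is not. *)
Definition jet_nabla_lie n k i j : F := jet_dlie n k i j
  + \sum_(m < 2) (G k n m * jet_lie m i j - G m n i * jet_lie k m j
                  - G m n j * jet_lie k i m).

(* The Palatini identity: the variation of the Ricci tensor under the variation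
   [L_K Gamma] of the connection. *)
Lemma jet_lie_ricciE j l : jet_lie_ricci j l =
  \sum_(k < 2) (jet_nabla_lie k k j l - jet_nabla_lie j k k l).
Proof.
(* Every symmetry is oriented from the index pair ([i1], [i0]) to ([i0], [i1]), so that equal jets
   become a single atom for [ring]. *)
have cG k := G_sym k i1 i0; have cdG m k := dG_sym m k i1 i0.
have cddG n m k := ddG_sym n m k i1 i0; have cddG' k i j := ddG_comm i1 i0 k i j.
have cK k := ddK_comm i1 i0 k; have cK3 i l' := dddK_comm i1 i0 i l'.
have cK3' i l' := dddK_comm' i i1 i0 l'.
elim/ord2_ind: j; elim/ord2_ind: l; rewrite /jet_lie_ricci /jet_nabla_lie
  /jet_dlie /jet_lie /jet_ricci /jet_dricci !sum_ord2;
  rewrite !(cG, cdG, cddG, cddG', cK, cK3, cK3'); ring.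
Qed.

Hypothesis F3 : 3 != 0 :> F.
Variables (r : 'I_2 -> F) (dr : 'I_2 -> 'I_2 -> F).
Hypothesis lieE : forall k i j,
  jet_lie k i j = (i == k)%:R * r j + (j == k)%:R * r i.
Hypothesis dlieE : forall n k i j,
  jet_dlie n k i j = (i == k)%:R * dr n j + (j == k)%:R * dr n i.

(** Inserting the projective equation into the Palatini identity gives L_K Ric_{ij} = nabla_j rho_i
    - 2 nabla_i rho_j. In the combination (2 Ric_{ij} + Ric_{ji}) / 3 the terms nabla_j rho_i cancel
    and - nabla_i rho_j remains. *)
Lemma jet_lie_schouten (P : 'I_2 -> 'I_2 -> F) (dP : 'I_2 -> 'I_2 -> 'I_2 -> F) :
  (forall i j, P i j = (2 * jet_ricci i j + jet_ricci j i) / 3) ->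
  (forall m i j, dP m i j = (2 * jet_dricci m i j + jet_dricci m j i) / 3) ->
  forall i j, \sum_(m < 2) K m * dP m i j
  + \sum_(m < 2) (P m j * dK i m + P i m * dK j m) + dr i j
  - \sum_(m < 2) G m i j * r m = 0.
Proof.
move=> PE dPE i j.
transitivity ((2 * jet_lie_ricci i j + jet_lie_ricci j i) / 3 + dr i j
              - \sum_(m < 2) G m i j * r m).
  by rewrite /jet_lie_ricci !sum_ord2 !PE !dPE; field.
rewrite !jet_lie_ricciE /jet_nabla_lie !sum_ord2 !lieE !dlieE.
have cG k := G_sym k i1 i0.
by elim/ord2_ind: i; elim/ord2_ind: j; rewrite /= ?cG; field.
Qed.

End JetIdentity.

(** * Projective vector fields and the Schouten tensor *)

(** Differentiates an expression by its structure, with [leaf] closing the atomic functions. The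
    derivative is left to unification, and [has_partial_eq] then compares it with the expected
    value. *)
Ltac derive_rules leaf := repeat first
  [ solve [leaf]
  | apply: has_partial_cst
  | apply: has_partial_sum => ?
  | apply: has_partialD
  | apply: has_partialN
  | apply: has_partialM ].

Section ProjectiveSurface.
Variables (R : realType) (U : set 'rV[R]_2).
Variables (Gam : 'I_2 -> 'I_2 -> 'I_2 -> 'rV[R]_2 -> R) (P : 'I_2 -> 'I_2 -> 'rV[R]_2 -> R).
Hypothesis oU : open U.
Hypothesis Gam_smooth : forall k i j, smooth_on U (Gam k i j).
Hypothesis Gam_sym : forall k i j x, U x -> Gam k i j x = Gam k j i x.
Hypothesis schouten : is_schouten U Gam P.

Definition ricci j l x : R :=
  jet_ricci (fun k i j => Gam k i j x) (fun m k i j => partial m (Gam k i j) x) j l.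

Definition dricci n j l x : R :=
  jet_dricci (fun k i j => Gam k i j x) (fun m k i j => partial m (Gam k i j) x)
    (fun n m k i j => partial n (partial m (Gam k i j)) x) n j l.

(** Contracting the definition of the Schouten tensor in dimension 2 gives Ric_{jl} = 2 P_{jl} -
    P_{lj}; this linear system is then solved for [P]. *)
Lemma schouten_ricci i j x : U x -> P i j x = (2 * ricci i j x + ricci j i x) / 3.
Proof.
move=> Ux.
have E j' l : ricci j' l x = \sum_(k < 2)
    (kdelta R k k * P j' l x - kdelta R j' k * P k l x
     - (P k j' x - P j' k x) * kdelta R l k).
  by apply: eq_bigr => k _; rewrite -schouten.
by rewrite !E !sum_ord2 /kdelta; elim/ord2_ind: i; elim/ord2_ind: j => /=; field.
Qed.

Lemma has_partial_ricci n j l x : U x ->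
  has_partial n (ricci j l) x (dricci n j l x).
Proof.
move=> Ux; rewrite /ricci /dricci /jet_ricci /jet_dricci.
have DG k i j' : has_partial n (Gam k i j') x (partial n (Gam k i j') x).
  exact: smooth_on_has_partial Ux.
have DDG m k i j' : has_partial n (partial m (Gam k i j')) x
    (partial n (partial m (Gam k i j')) x).
  by apply: smooth_on_has_partial Ux; exact: smooth_on_partial.
apply: has_partial_eq; first by derive_rules ltac:(first [exact: DG | exact: DDG]).
(* Here and below, [partial] is generalised so that comparing the atoms of a
   polynomial identity does not unfold it. *)
by move: (@partial R 2) => D; rewrite !sum_ord2; ring.
Qed.

Lemma smooth_on_ricci j l : smooth_on U (ricci j l).
Proof.
have sG := Gam_smooth; have sdG m k i j' := smooth_on_partial m (sG k i j').
rewrite /ricci /jet_ricci.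
apply: smooth_on_sum => // k; apply: smooth_onD => //.
  by apply: smooth_onD => //; apply: smooth_onN.
by apply: smooth_on_sum => // m; apply: smooth_onD => //;
  [|apply: smooth_onN => //]; apply: smooth_onM.
Qed.

Lemma smooth_on_schouten i j : smooth_on U (P i j).
Proof.
apply: (@smooth_on_eq _ _ U (fun x => (2 * ricci i j x + ricci j i x) * 3^-1)) => //.
  by move=> x Ux; rewrite -schouten_ricci.
by apply: smooth_onM => //; [apply: smooth_onD => //; [apply: smooth_onM => //|]|];
  first [exact: smooth_on_ricci | exact: smooth_on_cst].
Qed.

Lemma partial_schouten n i j x : U x ->
  partial n (P i j) x = (2 * dricci n i j x + dricci n j i x) / 3.
Proof.
move=> Ux.
rewrite (@partial_eq_on _ _ U _ (fun x => (2 * ricci i j x + ricci j i x) * 3^-1)) //.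
  apply: partial_val; apply: has_partial_eq.
    by derive_rules ltac:(exact: has_partial_ricci).
  by rewrite /=; field.
by move=> y Uy; exact: schouten_ricci.
Qed.

Variables K rho : 'I_2 -> 'rV[R]_2 -> R.

(** The trace of the projective equation over the upper and one lower index is 3 rho_i, which
    expresses [rho] through the jets of [K] and [Gam]. *)
Lemma projective_rho_smooth i : projective_vf U Gam K rho -> smooth_on U (rho i).
Proof.
move=> [sK KE].
apply: (@smooth_on_eq _ _ U (fun x => 3^-1 * \sum_(k < 2) lieGam K Gam k k i x)) => //.
  move=> x Ux; rewrite sum_ord2 !KE//.
  by elim/ord2_ind: i; rewrite /kdelta /=; field.
have sG := Gam_smooth; have sdG m k i j := smooth_on_partial m (sG k i j).
have sdK j k := smooth_on_partial j (sK k).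
have sddK i' j k := smooth_on_partial i' (sdK j k).
apply: smooth_onM => //; first exact: smooth_on_cst.
apply: smooth_on_sum => // k; rewrite /lieGam.
by repeat apply: smooth_onD => //; do ?[apply: smooth_onN => //];
   apply: smooth_on_sum => // m; apply: smooth_onM.
Qed.

(** This is L_K P_{ij} + nabla_i rho_j. Its symmetric part enters the Lie derivative of g, its
    antisymmetric part that of Omega. *)
Definition lie_schouten i j x : R :=
  \sum_(m < 2) K m x * partial m (P i j) x
  + \sum_(m < 2) (P m j x * partial i (K m) x + P i m x * partial j (K m) x)
  + partial i (rho j) x - \sum_(m < 2) Gam m i j x * rho m x.

Lemma projective_lie_schouten i j x : projective_vf U Gam K rho -> U x ->
  lie_schouten i j x = 0.
Proof.
move=> pK Ux; have [sK KE] := pK.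
have Dr i' n : has_partial n (rho i') x (partial n (rho i') x).
  by apply: smooth_on_has_partial Ux; exact: projective_rho_smooth.
have DG n k a b : has_partial n (Gam k a b) x (partial n (Gam k a b) x).
  exact: smooth_on_has_partial Ux.
have DDG n m k a b : has_partial n (partial m (Gam k a b)) x
    (partial n (partial m (Gam k a b)) x).
  by apply: smooth_on_has_partial Ux; exact: smooth_on_partial.
have sdK j k := smooth_on_partial j (sK k).
have sddK i' j k := smooth_on_partial i' (sdK j k).
have DK n k : has_partial n (K k) x (partial n (K k) x).
  exact: smooth_on_has_partial Ux.
have DDK n m k : has_partial n (partial m (K k)) x (partial n (partial m (K k)) x).
  exact: smooth_on_has_partial Ux.
have DDDK n m l k : has_partial n (partial m (partial l (K k))) x
    (partial n (partial m (partial l (K k))) x).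
  exact: smooth_on_has_partial Ux.
apply: (@jet_lie_schouten _ (fun k i j => Gam k i j x)
  (fun m k i j => partial m (Gam k i j) x)
  (fun n m k i j => partial n (partial m (Gam k i j)) x)
  (fun k => K k x) (fun i k => partial i (K k) x)
  (fun i j k => partial i (partial j (K k)) x)
  (fun i j k l => partial i (partial j (partial k (K l))) x)
  _ _ _ _ _ _ _ _
  (fun i => rho i x) (fun i j => partial i (rho j) x) _ _
  (fun i j => P i j x) (fun m i j => partial m (P i j) x)).
- by move=> k a b; exact: Gam_sym.
- by move=> m k a b; apply: (partial_eq_on m oU _ Ux) => y Uy; exact: Gam_sym.
- move=> n m k a b; apply: (partial_eq_on n oU _ Ux) => y Uy.
  by apply: (partial_eq_on m oU _ Uy) => z Uz; exact: Gam_sym.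
- by move=> n m k a b; exact: (partial_commute n m oU (Gam_smooth k a b) Ux).
- by move=> a b k; exact: (partial_commute a b oU (sK k) Ux).
- by move=> a b k l; exact: (partial_commute a b oU (sdK k l) Ux).
- move=> a b k l; apply: (partial_eq_on a oU _ Ux) => y Uy.
  exact: (partial_commute b k oU (sK l) Uy).
- by rewrite pnatr_eq0.
- move=> k a b; exact: KE.
- move=> n k a b.
  (* The projective equation holds on the open set [U], so it may be differentiated: its left side
     yields [jet_dlie], its right side the derivatives of [rho]. *)
  transitivity (partial n (lieGam K Gam k a b) x); last first.
    rewrite (partial_eq_on n oU (KE k a b) Ux); apply: partial_val.
    apply: has_partial_eq; first by derive_rules ltac:(exact: Dr).
    by rewrite /kdelta; move: (@partial R 2) => D; ring.
  apply/esym/partial_val; rewrite /lieGam.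
  move: (@partial R 2) DG DDG DK DDK DDDK => D DG DDG DK DDK DDDK.
  apply: has_partial_eq; first by derive_rules
    ltac:(first [exact: DG | exact: DDG | exact: DK | exact: DDK | exact: DDDK]).
  by rewrite /jet_dlie !sum_ord2; ring.
- by move=> a b; exact: schouten_ricci.
- by move=> m a b; exact: partial_schouten.
Qed.

End ProjectiveSurface.

(** * Functions on the cotangent bundle *)

Local Notation lx := (lshift 2).
Local Notation lp := (@rshift 2 2).

Section Cotangent.
Variable R : realType.

Definition base_index (a : 'I_(2 + 2)) : option 'I_2 :=
  if fintype.split a is inl i then Some i else None.

Lemma split_lx (i : 'I_2) : fintype.split (lx i) = inl i.
Proof. exact: (unsplitK (inl i)). Qed.

Lemma split_lp (i : 'I_2) : fintype.split (lp i) = inr i.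
Proof. exact: (unsplitK (inr i)). Qed.

Lemma xpart_shift a (h : R) y : xpart (h *: delta_mx 0 a + y) =
  h *: (if base_index a is Some j then delta_mx 0 j else 0) + xpart y.
Proof.
apply/rowP => i; elim/ord22_ind: a => j; rewrite /base_index ?split_lx ?split_lp !mxE.
  by rewrite eq_lshift.
by rewrite eq_lrshift andbF.
Qed.

Lemma differentiable_xpart (y : 'rV[R]_(2 + 2)) : differentiable (@xpart R) y.
Proof.
rewrite (_ : @xpart R = lsubmx); first exact: differentiable_lsubmx.
by apply/funext => z; apply/rowP => i; rewrite !mxE.
Qed.

Lemma smooth_on_xpart (U : set 'rV[R]_2) f : smooth_on U f ->
  smooth_on (cotU U) (fun y => f (xpart y)).
Proof.
exact: (smooth_on_subst differentiable_xpart xpart_shift).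
Qed.

Lemma partial_xpart_x f i y : partial (lx i) (fun z => f (xpart z)) y = partial i f (@xpart R y).
Proof. by rewrite (partial_subst xpart_shift) /base_index split_lx. Qed.

Lemma partial_xpart_p f i y : partial (lp i) (fun z => f (@xpart R z)) y = 0.
Proof. by rewrite (partial_subst xpart_shift) /base_index split_lp. Qed.

Lemma open_cotU (U : set 'rV[R]_2) : open U -> open (cotU U).
Proof.
move=> oU; apply: (open_comp _ oU) => y _.
exact: differentiable_continuous (differentiable_xpart y).
Qed.

(** Restriction to the zero section is how a field on the base and a 1-form are read off from a
    Killing field. *)
Definition zero_section (x : 'rV[R]_2) : 'rV[R]_(2 + 2) := row_mx x 0.

Lemma xpart_zero_section x : xpart (zero_section x) = x.
Proof. by apply/rowP => i; rewrite mxE row_mxEl. Qed.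

Lemma xipart_zero_section x i : xipart (zero_section x) i = 0.
Proof. by rewrite /xipart row_mxEr mxE. Qed.

(** The trivial match is the shape that [phi_shift] demands for [s i = Some (lx i)]. *)
Lemma zero_section_shift (i : 'I_2) (h : R) (x : 'rV[R]_2) : zero_section (h *: delta_mx 0 i + x) =
  h *: (if Some (lx i) is Some j then delta_mx 0 j else 0) + zero_section x.
Proof.
apply/rowP; elim/ord22_ind => j; rewrite !mxE.
  by rewrite split_lx !mxE eq_lshift.
by rewrite split_lp !mxE eq_rlshift andbF mulr0 addr0.
Qed.

Lemma differentiable_zero_section (x : 'rV[R]_2) : differentiable zero_section x.
Proof.
rewrite (_ : zero_section = \sum_(i < 2) fun z : 'rV[R]_2 =>
    z 0 i *: (delta_mx 0 (lx i) : 'rV[R]_(2 + 2))).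
  by apply: differentiable_sum => i; apply/differentiableZl/differentiable_coord.
apply/funext => z; rewrite fct_sumE; apply/rowP; elim/ord22_ind => j.
  by rewrite summxE row_mxEl sum_ord2 !mxE !eq_lshift;
    elim/ord2_ind: j; rewrite /= ?(mulr0, mulr1, addr0, add0r).
by rewrite summxE row_mxEr sum_ord2 !mxE !eq_rlshift !mulr0 addr0.
Qed.

Lemma smooth_on_zero_section (U : set 'rV[R]_2) f :
  smooth_on (cotU U) f -> smooth_on U (fun x => f (zero_section x)).
Proof.
move=> /(smooth_on_subst (s := fun i => Some (lx i)) differentiable_zero_section
  zero_section_shift).
rewrite (_ : [set _ | _] = U)//.
by apply/funext => x; rewrite /cotU /= xpart_zero_section.
Qed.

Lemma has_partial_xpart_x (f : 'rV[R]_2 -> R) i y d : has_partial i f (xpart y) d ->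
  has_partial (lx i) (fun z => f (xpart z)) y d.
Proof.
apply: is_derive_comp_affine => h.
by rewrite xpart_shift /base_index split_lx.
Qed.

Lemma has_partial_xpart_p (f : 'rV[R]_2 -> R) i y :
  has_partial (lp i) (fun z => f (@xpart R z)) y 0.
Proof.
apply: is_derive_comp_affine (is_derive0 f (xpart y)) => h.
by rewrite xpart_shift /base_index split_lp.
Qed.

Lemma has_partial_xipart_x i j (y : 'rV[R]_(2 + 2)) : has_partial (lx i) (fun z => xipart z j) y 0.
Proof.
by apply: has_partial_eq (has_partial_coord _ _ _) _; rewrite eq_lrshift.
Qed.

Lemma has_partial_xipart_p i j (y : 'rV[R]_(2 + 2)) :
  has_partial (lp i) (fun z => xipart z j) y (i == j)%:R.
Proof.
by apply: has_partial_eq (has_partial_coord _ _ _) _; rewrite eq_rshift.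
Qed.

Section Fibres.
Variables (U : set 'rV[R]_2) (f : 'rV[R]_(2 + 2) -> R).
Hypothesis sf : smooth_on (cotU U) f.
Hypothesis df0 : forall i y, cotU U y -> partial (lp i) f y = 0.

(** Fibres of T*U are whole planes, so the zero section is joined to [y] by moving along the two
    fibre directions without leaving the domain. *)
Lemma constant_on_fibre y : cotU U y -> f y = f (zero_section (xpart y)).
Proof.
move=> Uy.
have xE z i (t : R) : xpart (z + t *: delta_mx 0 (lp i)) = xpart z.
  by rewrite addrC xpart_shift /base_index split_lp scaler0 add0r.
have L z i t : cotU U z -> f (z + t *: delta_mx 0 (lp i)) = f z.
  move=> Uz; apply: constant_along_line => s; have Uzs : cotU U (z + s *: delta_mx 0 (lp i)).
    by rewrite /cotU xE.
  by rewrite -(df0 i Uzs); exact: (smooth_on_has_partial (lp i) sf Uzs).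
pose z := zero_section (xpart y).
have Uz : cotU U z by rewrite /cotU /= /z xpart_zero_section; exact: Uy.
have -> : y = z + xipart y i0 *: delta_mx 0 (lp i0) + xipart y i1 *: delta_mx 0 (lp i1).
  apply/rowP; elim/ord22_ind => i; rewrite !mxE ?split_lx ?split_lp !mxE;
    rewrite ?eq_lrshift ?eq_rshift ?eqxx /= ?mulr0 ?addr0 ?add0r//.
  by elim/ord2_ind: i; rewrite /= ?(mulr0, mulr1, addr0, add0r).
rewrite !L //; last by rewrite /cotU xE.
by rewrite !xE xpart_zero_section.
Qed.

End Fibres.
End Cotangent.

(** * Lie derivatives along the lift *)

Lemma lie2_ord22 (R : realType) (X : 'I_(2 + 2) -> 'rV[R]_(2 + 2) -> R)
    (T : 'rV[R]_(2 + 2) -> 'I_(2 + 2) -> 'I_(2 + 2) -> R) y a b :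
  lie2 X T y a b =
  X (lx i0) y * partial (lx i0) (fun z => T z a b) y
  + X (lx i1) y * partial (lx i1) (fun z => T z a b) y
  + (X (lp i0) y * partial (lp i0) (fun z => T z a b) y
     + X (lp i1) y * partial (lp i1) (fun z => T z a b) y)
  + (T y (lx i0) b * partial a (X (lx i0)) y + T y (lx i1) b * partial a (X (lx i1)) y
     + (T y (lp i0) b * partial a (X (lp i0)) y + T y (lp i1) b * partial a (X (lp i1)) y))
  + (T y a (lx i0) * partial b (X (lx i0)) y + T y a (lx i1) * partial b (X (lx i1)) y
     + (T y a (lp i0) * partial b (X (lp i0)) y + T y a (lp i1) * partial b (X (lp i1)) y)).
Proof. by rewrite /lie2; move: (@partial R _) => D; rewrite !sum_ord22. Qed.

(** * Components of g and Omega, and of the Lie derivative of g along an arbitrary field *)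

Section Components.
Variables (R : realType) (Gam : 'I_2 -> 'I_2 -> 'I_2 -> 'rV[R]_2 -> R).
Variables (P : 'I_2 -> 'I_2 -> 'rV[R]_2 -> R) (Lam : R).

Lemma dx_lx i j : dx R i (lx j) = (j == i)%:R.
Proof. by rewrite /dx eq_lshift. Qed.

Lemma dx_lp i j : dx R i (lp j) = 0.
Proof. by rewrite /dx eq_rlshift. Qed.

Lemma dxi_lx i j : dxi R i (lx j) = 0.
Proof. by rewrite /dxi eq_lrshift. Qed.

Lemma dxi_lp i j : dxi R i (lp j) = (j == i)%:R.
Proof. by rewrite /dxi eq_rshift. Qed.

Definition coefS i j (y : 'rV[R]_(2 + 2)) : R :=
  (coefA Gam P Lam i j y + coefA Gam P Lam j i y) / 2.

Ltac components := rewrite /metric_g /omega /symprod /wedge /coefS !sum_ord2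
  ?(dx_lx, dx_lp, dxi_lx, dxi_lp).

Lemma metric_xx y i j : metric_g Gam P Lam y (lx i) (lx j) = - coefS i j y.
Proof.
by components; elim/ord2_ind: i; elim/ord2_ind: j => /=; field.
Qed.

Lemma metric_px y i j : metric_g Gam P Lam y (lp i) (lx j) = (i == j)%:R / 2.
Proof.
by components; elim/ord2_ind: i; elim/ord2_ind: j => /=; field.
Qed.

Lemma metric_xp y i j : metric_g Gam P Lam y (lx i) (lp j) = (i == j)%:R / 2.
Proof.
by components; elim/ord2_ind: i; elim/ord2_ind: j => /=; field.
Qed.

Lemma metric_pp y i j : metric_g Gam P Lam y (lp i) (lp j) = 0.
Proof.
by components; elim/ord2_ind: i; elim/ord2_ind: j => /=; field.
Qed.

Lemma omega_xx y i j : omega P Lam y (lx i) (lx j) =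
  Lam^-1 * (P i j (xpart y) - P j i (xpart y)).
Proof.
by components; elim/ord2_ind: i; elim/ord2_ind: j => /=; ring.
Qed.

Lemma omega_px y i j : omega P Lam y (lp i) (lx j) = (i == j)%:R.
Proof.
by components; elim/ord2_ind: i; elim/ord2_ind: j => /=; ring.
Qed.

Lemma omega_xp y i j : omega P Lam y (lx i) (lp j) = - (i == j)%:R.
Proof.
by components; elim/ord2_ind: i; elim/ord2_ind: j => /=; ring.
Qed.

Lemma omega_pp y i j : omega P Lam y (lp i) (lp j) = 0.
Proof.
by components; elim/ord2_ind: i; elim/ord2_ind: j => /=; ring.
Qed.

Lemma partial_cst n c (k : R) (x : 'rV[R]_n) : partial c (fun=> k) x = 0.
Proof. exact: partial_val (has_partial_cst _ _ _). Qed.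

Lemma lie2_metric_pp X y i j : lie2 X (metric_g Gam P Lam) y (lp i) (lp j) =
  (partial (lp i) (X (lx j)) y + partial (lp j) (X (lx i)) y) / 2.
Proof.
rewrite lie2_ord22.
have -> : (fun z => metric_g Gam P Lam z (lp i) (lp j)) = fun=> 0.
  by apply/funext => z; rewrite metric_pp.
rewrite !partial_cst !(metric_xp, metric_px, metric_pp).
move: (@partial R _) => D.
by elim/ord2_ind: i; elim/ord2_ind: j => /=; field.
Qed.

Lemma lie2_metric_px X y i j : lie2 X (metric_g Gam P Lam) y (lp i) (lx j) =
  (partial (lp i) (X (lp j)) y + partial (lx j) (X (lx i)) y) / 2
  - \sum_(k < 2) coefS k j y * partial (lp i) (X (lx k)) y.
Proof.
rewrite lie2_ord22 sum_ord2.
have -> : (fun z => metric_g Gam P Lam z (lp i) (lx j)) = fun=> (i == j)%:R / 2.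
  by apply/funext => z; rewrite metric_px.
rewrite !partial_cst !(metric_xx, metric_xp, metric_px, metric_pp).
move: (@partial R _) coefS => D S.
by elim/ord2_ind: i; elim/ord2_ind: j => /=; field.
Qed.

Lemma lie2_metric_xx X y i j : lie2 X (metric_g Gam P Lam) y (lx i) (lx j) =
  (partial (lx i) (X (lp j)) y + partial (lx j) (X (lp i)) y) / 2
  + \sum_(m < 2) (X (lx m) y * partial (lx m) (fun z => - coefS i j z) y
                  + X (lp m) y * partial (lp m) (fun z => - coefS i j z) y)
  - \sum_(k < 2) (coefS k j y * partial (lx i) (X (lx k)) y
                  + coefS i k y * partial (lx j) (X (lx k)) y).
Proof.
rewrite lie2_ord22 !sum_ord2.
have -> : (fun z => metric_g Gam P Lam z (lx i) (lx j)) = fun z => - coefS i j z.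
  by apply/funext => z; rewrite metric_xx.
rewrite !(metric_xx, metric_xp, metric_px, metric_pp).
move: (@partial R _) coefS => D S.
by elim/ord2_ind: i; elim/ord2_ind: j => /=; field.
Qed.

Lemma lie2_metric_sym X y a b :
  lie2 X (metric_g Gam P Lam) y a b = lie2 X (metric_g Gam P Lam) y b a.
Proof.
have gC z c d : metric_g Gam P Lam z c d = metric_g Gam P Lam z d c.
  by apply: eq_bigr => i _; rewrite /symprod addrC [X in X + _]mulrC [X in _ + X]mulrC.
have fE : (fun z => metric_g Gam P Lam z a b) = fun z => metric_g Gam P Lam z b a.
  by apply/funext => z; exact: gC.
rewrite /lie2 fE; move: (@partial R _) => D; rewrite [LHS]addrAC.
by congr (_ + _ + _); apply: eq_bigr => c _; rewrite gC.
Qed.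

End Components.

(** * The lift of a pair (K, rho) *)

Section Lift.
Variables (R : realType) (U : set 'rV[R]_2).
Variables (Gam : 'I_2 -> 'I_2 -> 'I_2 -> 'rV[R]_2 -> R).
Variables (P : 'I_2 -> 'I_2 -> 'rV[R]_2 -> R) (Lam : R).
Hypothesis oU : open U.
Hypothesis Gam_smooth : forall k i j, smooth_on U (Gam k i j).
Hypothesis Gam_sym : forall k i j x, U x -> Gam k i j x = Gam k j i x.
Hypothesis P_smooth : forall i j, smooth_on U (P i j).
Hypothesis Lam0 : Lam != 0.

Lemma has_partial_coefA_x m i j y : cotU U y ->
  has_partial (lx m) (coefA Gam P Lam i j) y
    (\sum_(k < 2) partial m (Gam k i j) (xpart y) * xipart y k
     - Lam^-1 * partial m (P j i) (xpart y)).
Proof.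
move=> Uy; rewrite /coefA.
have DG k : has_partial (lx m) (fun z => Gam k i j (xpart z)) y
    (partial m (Gam k i j) (xpart y)).
  apply: has_partial_xpart_x; exact: (smooth_on_has_partial m (Gam_smooth k i j) Uy).
have DP : has_partial (lx m) (fun z => P j i (xpart z)) y (partial m (P j i) (xpart y)).
  apply: has_partial_xpart_x; exact: (smooth_on_has_partial m (P_smooth j i) Uy).
apply: has_partial_eq; first by
  derive_rules ltac:(first [exact: DG | exact: DP | exact: has_partial_xipart_x]).
by move: (@partial R _) => D; rewrite !sum_ord2; ring.
Qed.

Lemma has_partial_coefA_p m i j y :
  has_partial (lp m) (coefA Gam P Lam i j) y
    (Gam m i j (xpart y) - Lam * ((m == i)%:R * xipart y j + xipart y i * (m == j)%:R)).
Proof.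
rewrite /coefA; apply: has_partial_eq; first by
  derive_rules ltac:(first [exact: has_partial_xpart_p | exact: has_partial_xipart_p]).
by rewrite !sum_ord2; elim/ord2_ind: m => /=; ring.
Qed.

Lemma has_partial_coefS c i j y (a b : R) :
  has_partial c (coefA Gam P Lam i j) y a -> has_partial c (coefA Gam P Lam j i) y b ->
  has_partial c (coefS Gam P Lam i j) y ((a + b) / 2).
Proof.
move=> Da Db; rewrite /coefS; apply: has_partial_eq; first by
  derive_rules ltac:(first [exact: Da | exact: Db]).
by rewrite mulr0 add0r mulrC.
Qed.

Variables K rho : 'I_2 -> 'rV[R]_2 -> R.
Hypothesis K_smooth : forall k, smooth_on U (K k).
Hypothesis rho_smooth : forall i, smooth_on U (rho i).

Lemma cot_lift_x i : cot_lift K rho Lam (lx i) = fun y => K i (xpart y).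
Proof. by apply/funext => y; rewrite /cot_lift split_lx. Qed.

Lemma cot_lift_p i : cot_lift K rho Lam (lp i) = fun y =>
  - \sum_(j < 2) xipart y j * partial i (K j) (xpart y) + Lam^-1 * rho i (xpart y).
Proof. by apply/funext => y; rewrite /cot_lift split_lp. Qed.

Lemma smooth_on_cot_lift a : smooth_on (cotU U) (cot_lift K rho Lam a).
Proof.
have oT := open_cotU oU.
elim/ord22_ind: a => i; first by rewrite cot_lift_x; exact: smooth_on_xpart.
rewrite cot_lift_p; apply: smooth_onD => //.
  apply: smooth_onN => //; apply: smooth_on_sum => // j.
  apply: smooth_onM => //; first exact: smooth_on_coord.
  by apply: (smooth_on_xpart (f := partial i (K j))); exact: smooth_on_partial.
by apply: smooth_onM => //; [exact: smooth_on_cst | exact: smooth_on_xpart].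
Qed.

Lemma partial_lift_xx i j y :
  partial (lx i) (cot_lift K rho Lam (lx j)) y = partial i (K j) (xpart y).
Proof. by rewrite cot_lift_x partial_xpart_x. Qed.

Lemma partial_lift_px i j y :
  partial (lp i) (cot_lift K rho Lam (lx j)) y = 0.
Proof. by rewrite cot_lift_x partial_xpart_p. Qed.

Lemma partial_lift_xp i j y : cotU U y ->
  partial (lx i) (cot_lift K rho Lam (lp j)) y =
  - \sum_(k < 2) xipart y k * partial i (partial j (K k)) (xpart y)
  + Lam^-1 * partial i (rho j) (xpart y).
Proof.
move=> Uy; rewrite cot_lift_p; apply: partial_val.
have DK k : has_partial (lx i) (fun z => partial j (K k) (xpart z)) y
    (partial i (partial j (K k)) (xpart y)).
  apply: has_partial_xpart_x.
  exact: (smooth_on_has_partial i (smooth_on_partial j (K_smooth k)) Uy).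
have Dr : has_partial (lx i) (fun z => rho j (xpart z)) y (partial i (rho j) (xpart y)).
  apply: has_partial_xpart_x; exact: (smooth_on_has_partial i (rho_smooth j) Uy).
apply: has_partial_eq; first by
  derive_rules ltac:(first [exact: DK | exact: Dr | exact: has_partial_xipart_x]).
by move: (@partial R _) => D; rewrite !sum_ord2; ring.
Qed.

Lemma partial_lift_pp i j y :
  partial (lp i) (cot_lift K rho Lam (lp j)) y = - partial j (K i) (xpart y).
Proof.
rewrite cot_lift_p; apply: partial_val.
have DK k : has_partial (lp i) (fun z => partial j (K k) (xpart z)) y 0.
  exact: (has_partial_xpart_p (partial j (K k))).
apply: has_partial_eq; first by
  derive_rules ltac:(first [exact: DK | exact: has_partial_xpart_p
                           | exact: has_partial_xipart_p]).
by move: (@partial R _) => D; rewrite !sum_ord2; elim/ord2_ind: i {DK} => /=; ring.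
Qed.

Lemma lie2_metric_lift_pp y i j :
  lie2 (cot_lift K rho Lam) (metric_g Gam P Lam) y (lp i) (lp j) = 0.
Proof. by rewrite lie2_metric_pp !partial_lift_px// addr0 mul0r. Qed.

(** The fibre derivative of the term - xi_k d_j K^k is - d_j K^i, which cancels the base derivative
    of K^i whatever [rho] is. *)
Lemma lie2_metric_lift_px y i j :
  lie2 (cot_lift K rho Lam) (metric_g Gam P Lam) y (lp i) (lx j) = 0.
Proof.
rewrite lie2_metric_px sum_ord2 !partial_lift_px// partial_lift_pp//.
by rewrite partial_lift_xx// addNr mul0r !mulr0 addr0 subr0.
Qed.

(** No term quadratic in xi survives: Lambda xi_i xi_j dx^i dx^j is Lambda times the square of the
    tautological form, which the part of the lift without [rho] preserves. The vertical shift by rho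
    / Lambda turns this square into the linear terms with [rho], and contributes nabla rho to the
    constant part. *)
Lemma lie2_metric_lift_xx y i j : cotU U y ->
  lie2 (cot_lift K rho Lam) (metric_g Gam P Lam) y (lx i) (lx j) =
  Lam^-1 * ((lie_schouten Gam P K rho i j (xpart y)
             + lie_schouten Gam P K rho j i (xpart y)) / 2)
  - \sum_(k < 2) xipart y k * (lieGam K Gam k i j (xpart y)
      - (kdelta R i k * rho j (xpart y) + kdelta R j k * rho i (xpart y))).
Proof.
move=> Uy; rewrite lie2_metric_xx.
have DSx m : partial (lx m) (fun z => - coefS Gam P Lam i j z) y = _ :=
  partial_val (has_partialN (has_partial_coefS
    (has_partial_coefA_x m i j Uy) (has_partial_coefA_x m j i Uy))).
have DSp m : partial (lp m) (fun z => - coefS Gam P Lam i j z) y = _ :=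
  partial_val (has_partialN (has_partial_coefS
    (has_partial_coefA_p m i j y) (has_partial_coefA_p m j i y))).
rewrite !sum_ord2 !DSx !DSp !partial_lift_xx// !partial_lift_xp//.
have cG k : Gam k i1 i0 (xpart y) = Gam k i0 i1 (xpart y) by exact: Gam_sym.
have cdG m k : partial m (Gam k i1 i0) (xpart y) = partial m (Gam k i0 i1) (xpart y).
  by apply: (partial_eq_on m oU _ Uy) => x Ux; exact: Gam_sym.
have cK k : partial i1 (partial i0 (K k)) (xpart y)
          = partial i0 (partial i1 (K k)) (xpart y).
  exact: (partial_commute i1 i0 oU (K_smooth k) Uy).
rewrite !(cot_lift_x i0, cot_lift_x i1) !(cot_lift_p i0, cot_lift_p i1).
rewrite /coefS /coefA /lie_schouten /lieGam /kdelta.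
move: (@partial R _) cdG cK => D cdG cK; rewrite !sum_ord2 {DSx DSp}.
by elim/ord2_ind: i; elim/ord2_ind: j; rewrite /= !(cG, cdG, cK); field.
Qed.

(** The part of the lift without [rho] preserves d xi_i /\ dx^i, and the vertical shift adds d rho /
    Lambda. As the connection is torsion-free, d rho is the antisymmetrised nabla rho, which cancels
    against L_K P. *)
Lemma lie2_omega_lift y a b : cotU U y ->
  (forall i j, lie_schouten Gam P K rho i j (xpart y) = 0) ->
  lie2 (cot_lift K rho Lam) (omega P Lam) y a b = 0.
Proof.
move=> Uy LS.
have Exx i j : (fun z => omega P Lam z (lx i) (lx j)) =
    fun z => Lam^-1 * (P i j (xpart z) - P j i (xpart z)).
  by apply/funext => z; rewrite omega_xx.
have Epx i j : (fun z => omega P Lam z (lp i) (lx j)) = fun=> (i == j)%:R.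
  by apply/funext => z; rewrite omega_px.
have Exp i j : (fun z => omega P Lam z (lx i) (lp j)) = fun=> - (i == j)%:R.
  by apply/funext => z; rewrite omega_xp.
have Epp i j : (fun z => omega P Lam z (lp i) (lp j)) = fun=> 0.
  by apply/funext => z; rewrite omega_pp.
have DP m i j : has_partial (lx m) (fun z => P i j (xpart z)) y
    (partial m (P i j) (xpart y)).
  apply: has_partial_xpart_x; exact: (smooth_on_has_partial m (P_smooth i j) Uy).
have Dx m i j : partial (lx m) (fun z => omega P Lam z (lx i) (lx j)) y =
    Lam^-1 * (partial m (P i j) (xpart y) - partial m (P j i) (xpart y)).
  rewrite Exx; apply: partial_val; apply: has_partial_eq.
    by derive_rules ltac:(exact: DP).
  by move: (@partial R _) => D; ring.
have Dp m i j : partial (lp m) (fun z => omega P Lam z (lx i) (lx j)) y = 0.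
  rewrite Exx; apply: partial_val; apply: has_partial_eq.
    by derive_rules ltac:(exact: has_partial_xpart_p).
  by ring.
have cG k : Gam k i1 i0 (xpart y) = Gam k i0 i1 (xpart y) by exact: Gam_sym.
have LSa i j : lie_schouten Gam P K rho i j (xpart y)
             - lie_schouten Gam P K rho j i (xpart y) = 0 by rewrite !LS subrr.
elim/ord22_ind: a => i; elim/ord22_ind: b => j; rewrite lie2_ord22.
- rewrite !Dx !Dp !(omega_xx, omega_xp, omega_px) !partial_lift_xx//.
  rewrite !partial_lift_xp// !(cot_lift_x i0, cot_lift_x i1).
  (* The zero on the right is traded for the antisymmetric part of [lie_schouten], making the goal a
     polynomial identity in the jets. *)
  rewrite -[RHS](mulr0 Lam^-1) -[X in _ = _ * X](LSa i j) /lie_schouten.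
  have cK k : partial i1 (partial i0 (K k)) (xpart y)
            = partial i0 (partial i1 (K k)) (xpart y).
    exact: (partial_commute i1 i0 oU (K_smooth k) Uy).
  move: (@partial R _) cK => D cK; rewrite !sum_ord2.
  by elim/ord2_ind: i; elim/ord2_ind: j; rewrite /= ?(cG, cK); ring.
- rewrite Exp !partial_cst !(omega_xx, omega_xp, omega_px, omega_pp).
  rewrite !partial_lift_px// !partial_lift_pp// !partial_lift_xx//.
  move: (@partial R _) => D.
  by elim/ord2_ind: i; elim/ord2_ind: j; rewrite /=; ring.
- rewrite Epx !partial_cst !(omega_xx, omega_xp, omega_px, omega_pp).
  rewrite !partial_lift_px// !partial_lift_pp// !partial_lift_xx//.
  move: (@partial R _) => D.
  by elim/ord2_ind: i; elim/ord2_ind: j; rewrite /=; ring.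
- rewrite Epp !partial_cst !(omega_xx, omega_xp, omega_px, omega_pp).
  have E m k : partial (lp m) (cot_lift K rho Lam (lx k)) y = 0 := partial_lift_px m k y.
  by move: (@partial R _) E => D E; rewrite !E; ring.
Qed.

End Lift.

(** * Killing fields are lifts *)

Lemma partial_eq0_on (R : realType) n (A : set 'rV[R]_n) f i x :
  open A -> (forall y, A y -> f y = 0) -> A x -> partial i f x = 0.
Proof.
move=> oA f0 Ax; rewrite (@partial_eq_on _ _ _ _ (fun=> 0) _ _ oA f0 Ax).
exact: partial_cst.
Qed.

Section Converse.
Variables (R : realType) (U : set 'rV[R]_2).
Variables (Gam : 'I_2 -> 'I_2 -> 'I_2 -> 'rV[R]_2 -> R).
Variables (P : 'I_2 -> 'I_2 -> 'rV[R]_2 -> R) (Lam : R).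
Hypothesis oU : open U.
Hypothesis Gam_smooth : forall k i j, smooth_on U (Gam k i j).
Hypothesis Gam_sym : forall k i j x, U x -> Gam k i j x = Gam k j i x.
Hypothesis P_smooth : forall i j, smooth_on U (P i j).
Hypothesis Lam0 : Lam != 0.
Variable X : 'I_(2 + 2) -> 'rV[R]_(2 + 2) -> R.
Hypothesis X_smooth : forall a, smooth_on (cotU U) (X a).
Hypothesis X_killing : forall y, cotU U y -> forall a b,
  lie2 X (metric_g Gam P Lam) y a b = 0.

Let oT : open (cotU U) := open_cotU oU.
Local Notation T := (cotU U).
Local Notation S := (coefS Gam P Lam).

Let killing_pp i j y : T y -> partial (lp i) (X (lx j)) y = - partial (lp j) (X (lx i)) y.
Proof.
move=> Ty; have := X_killing Ty (lp i) (lp j); rewrite lie2_metric_pp => /eqP.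
by rewrite mulf_eq0 invr_eq0 pnatr_eq0 orbF addr_eq0 => /eqP.
Qed.

Let killing_px i j y : T y -> partial (lp i) (X (lp j)) y =
  - partial (lx j) (X (lx i)) y
  + 2 * (S i0 j y * partial (lp i) (X (lx i0)) y + S i1 j y * partial (lp i) (X (lx i1)) y).
Proof.
move=> Ty; have := X_killing Ty (lp i) (lx j); rewrite lie2_metric_px sum_ord2.
move: (@partial R _) S => D S' E.
by rewrite -[RHS]addr0 -[X in _ = _ + X](mulr0 2) -[X in _ = _ + 2 * X]E; field.
Qed.

Let dp_diag i y : T y -> partial (lp i) (X (lx i)) y = 0.
Proof.
move=> Ty; have /eqP := killing_pp i i Ty.
by rewrite -addr_eq0 -mulr2n mulrn_eq0 => /eqP.
Qed.

(* The base components of a Killing field are [K^i(x) + b(x) eps^{ij} xi_j];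
   the mixed equations force [b = 0]. *)
Let b := partial (lp i1) (X (lx i0)).

Let b_smooth : smooth_on T b.
Proof. exact: smooth_on_partial. Qed.

(** Commuting the fibre derivatives, after a use of skew-symmetry when [m] is [i1], reduces the
    claim to [dp_diag]; thus [b] is constant on fibres. *)
Let dp_b m y : T y -> partial (lp m) b y = 0.
Proof.
move=> Ty; elim/ord2_ind: m.
  rewrite (partial_commute _ _ oT (X_smooth (lx i0)) Ty).
  by apply: partial_eq0_on oT _ Ty => z Tz; exact: dp_diag.
rewrite (partial_eq_on _ oT (fun z Tz => killing_pp i1 i0 Tz) Ty).
rewrite (partial_val (has_partialN (smooth_on_has_partial (lp i1)
  (smooth_on_partial (lp i0) (X_smooth (lx i1))) Ty))).
rewrite (partial_commute _ _ oT (X_smooth (lx i1)) Ty).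
by rewrite (partial_eq0_on _ oT _ Ty) ?oppr0// => z Tz; exact: dp_diag.
Qed.

(** The fibre divergence of [coefS], that is the sum over m of the xi_m-derivatives of [S m i0]. *)
Let divS y : R := (Gam i0 i0 i0 (xpart y) *+ 2 + Gam i1 i1 i0 (xpart y)
  + Gam i1 i0 i1 (xpart y)) / 2 - 3 * Lam * xipart y i0.

(** The mixed equations give both fibre derivatives of [X (lp i0)]; the claim is the equality of
    their cross derivatives, computed in [F0] and [F1]. *)
Let dx_b y : T y -> partial (lx i0) b y + b y * divS y = 0.
Proof.
move=> Ty.
pose dS m i j : R :=
  (Gam m i j (xpart y) - Lam * ((m == i)%:R * xipart y j + xipart y i * (m == j)%:R)
   + (Gam m j i (xpart y) - Lam * ((m == j)%:R * xipart y i + xipart y j * (m == i)%:R)))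
  / 2.
have DS m i j : has_partial (lp m) (S i j) y (dS m i j).
  exact: has_partial_coefS (has_partial_coefA_p _ _ _ _ _ _ _)
    (has_partial_coefA_p _ _ _ _ _ _ _).
have Db m : has_partial (lp m) b y 0.
  by rewrite -(dp_b m Ty); exact: (smooth_on_has_partial (lp m) b_smooth Ty).
have DDX m a c : has_partial (lp m) (partial a (X c)) y (partial (lp m) (partial a (X c)) y).
  exact: (smooth_on_has_partial (lp m) (smooth_on_partial a (X_smooth c)) Ty).
have E0 z : T z -> partial (lp i0) (X (lp i0)) z =
    - partial (lx i0) (X (lx i0)) z - 2 * (S i1 i0 z * b z).
  by move=> Tz; rewrite killing_px// dp_diag// (killing_pp i0 i1 Tz) /b; ring.
have E1 z : T z -> partial (lp i1) (X (lp i0)) z =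
    - partial (lx i0) (X (lx i1)) z + 2 * (S i0 i0 z * b z).
  by move=> Tz; rewrite killing_px// dp_diag// /b; ring.
have F0 : partial (lp i1) (fun z => - partial (lx i0) (X (lx i0)) z
      - 2 * (S i1 i0 z * b z)) y = - partial (lx i0) b y - 2 * (b y * dS i1 i1 i0).
  rewrite -(partial_commute (lp i1) (lx i0) oT (X_smooth (lx i0)) Ty).
  apply: partial_val; apply: has_partial_eq.
    by derive_rules ltac:(first [exact: DS | exact: Db | exact: DDX]).
  by move: (@partial R _) => D; ring.
have F1 : partial (lp i0) (fun z => - partial (lx i0) (X (lx i1)) z
      + 2 * (S i0 i0 z * b z)) y = partial (lx i0) b y + 2 * (b y * dS i0 i0 i0).
  have -> : partial (lx i0) b y = - partial (lp i0) (partial (lx i0) (X (lx i1))) y.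
    rewrite (partial_commute (lp i0) (lx i0) oT (X_smooth (lx i1)) Ty).
    rewrite (partial_eq_on _ oT (fun z Tz => killing_pp i1 i0 Tz) Ty).
    apply: partial_val; apply: has_partialN.
    exact: (smooth_on_has_partial _ (smooth_on_partial _ (X_smooth (lx i1))) Ty).
  apply: partial_val; apply: has_partial_eq.
    by derive_rules ltac:(first [exact: DS | exact: Db | exact: DDX]).
  by move: (@partial R _) => D; ring.
have := partial_commute (lp i1) (lp i0) oT (X_smooth (lp i0)) Ty.
rewrite (partial_eq_on _ oT E0 Ty) (partial_eq_on _ oT E1 Ty) F0 F1 /dS /divS /=.
move: (partial (lx i0) b y) (b y) => db b' E.
(* The two cross derivatives differ by twice the expression to be annihilated. *)
apply: (@mulfI _ 2); first by rewrite pnatr_eq0.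
rewrite mulr0; apply/eqP; rewrite -[X in X == 0]opprK oppr_eq0; apply/eqP.
by move/eqP: E; rewrite -subr_eq0 => /eqP <-; field.
Qed.

Let b0 y : T y -> b y = 0.
Proof.
move=> Ty; have := partial_eq0_on (lp i0) oT dx_b Ty.
have Db : has_partial (lp i0) b y 0.
  by rewrite -(dp_b i0 Ty); exact: (smooth_on_has_partial (lp i0) b_smooth Ty).
(* The base derivative of [b] is constant on fibres too, so only the term - 3 Lambda xi of [divS]
   contributes below. *)
have Ddb : has_partial (lp i0) (partial (lx i0) b) y 0.
  have <- : partial (lp i0) (partial (lx i0) b) y = 0.
    rewrite (partial_commute (lp i0) (lx i0) oT b_smooth Ty).
    by apply: partial_eq0_on oT _ Ty => z; exact: dp_b.
  exact: (smooth_on_has_partial _ (smooth_on_partial _ b_smooth) Ty).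
have DG k i j : has_partial (lp i0) (fun z => Gam k i j (xpart z)) y 0.
  exact: has_partial_xpart_p.
have E : has_partial (lp i0) (fun z => partial (lx i0) b z + b z * divS z) y
    (- 3 * Lam * b y).
  rewrite /divS; under eq_fun do rewrite mulr2n.
  apply: has_partial_eq.
    by derive_rules ltac:(first [exact: Db | exact: Ddb | exact: DG
                                | exact: has_partial_xipart_p]).
  by rewrite /=; ring.
rewrite (partial_val E) => /eqP; rewrite !mulf_eq0 oppr_eq0 pnatr_eq0 (negPf Lam0) /=.
by move/eqP.
Qed.

Let dp_base i j y : T y -> partial (lp i) (X (lx j)) y = 0.
Proof.
move=> Ty; elim/ord2_ind: i; elim/ord2_ind: j.
- exact: dp_diag.
- by rewrite killing_pp// -/b b0// oppr0.
- exact: b0.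
- exact: dp_diag.
Qed.

Definition base_field i x : R := X (lx i) (zero_section x).
(** On the zero section the fibre components of a lift are rho_i / Lambda; the factor [Lam] undoes
    this. *)
Definition base_form i x : R := Lam * X (lp i) (zero_section x).

Lemma smooth_on_base_field i : smooth_on U (base_field i).
Proof. exact: smooth_on_zero_section. Qed.

Lemma smooth_on_base_form i : smooth_on U (base_form i).
Proof.
apply: smooth_onM => //; first exact: smooth_on_cst.
exact: (smooth_on_zero_section (f := X (lp i))).
Qed.

Lemma killing_xE i y : T y -> X (lx i) y = base_field i (xpart y).
Proof. by move=> Ty; apply: constant_on_fibre Ty => // j z; exact: dp_base. Qed.

Lemma partial_killing_x i j y : T y ->
  partial (lx i) (X (lx j)) y = partial i (base_field j) (xpart y).
Proof.
move=> Ty; rewrite (partial_eq_on _ oT (fun z Tz => killing_xE j Tz) Ty).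
exact: partial_xpart_x.
Qed.

Lemma killing_liftE a y : T y -> X a y = cot_lift base_field base_form Lam a y.
Proof.
elim/ord22_ind: a => i Ty; first by rewrite cot_lift_x killing_xE.
(* Adding back the expected linear part leaves a function whose fibre derivatives vanish by the
   mixed equations, so it equals its value on the zero section. *)
pose Z z := X (lp i) z + \sum_(k < 2) xipart z k * partial i (base_field k) (xpart z).
have sZ : smooth_on T Z.
  apply: smooth_onD => //; apply: smooth_on_sum => // k.
  apply: smooth_onM => //; first exact: smooth_on_coord.
  apply: (smooth_on_xpart (f := partial i (base_field k))).
  exact/smooth_on_partial/smooth_on_base_field.
have dZ m z : T z -> partial (lp m) Z z = 0.
  move=> Tz; apply: partial_val.
  have DX : has_partial (lp m) (X (lp i)) z (- partial i (base_field m) (xpart z)).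
    rewrite -partial_killing_x//.
    have <- : partial (lp m) (X (lp i)) z = - partial (lx i) (X (lx m)) z.
      by rewrite killing_px// !dp_base// !mulr0 addr0 mulr0 addr0.
    exact: (smooth_on_has_partial (lp m) (X_smooth (lp i)) Tz).
  have DK k : has_partial (lp m) (fun z => partial i (base_field k) (xpart z)) z 0.
    exact: (has_partial_xpart_p (partial i (base_field k))).
  apply: has_partial_eq.
    by derive_rules ltac:(first [exact: DX | exact: DK | exact: has_partial_xipart_p]).
  by rewrite !sum_ord2; move: (@partial R _) => D; elim/ord2_ind: m {DX DK} => /=; ring.
have := constant_on_fibre sZ dZ Ty; rewrite /Z.
rewrite [in RHS]big1 ?addr0 => [E|k _]; last by rewrite xipart_zero_section mul0r.
by rewrite cot_lift_p /base_form mulKf// -E addrC addrK.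
Qed.

Lemma base_projective : projective_vf U Gam base_field base_form.
Proof.
split=> [k|k i j x Ux]; first exact: smooth_on_base_field.
(* Since [X] coincides with the lift on an open set, their Lie derivatives agree. Over a fixed [x]
   the base component is thus an affine function of the covector [v] that vanishes identically. *)
have L (v : 'rV[R]_2) :
    Lam^-1 * ((lie_schouten Gam P base_field base_form i j x
               + lie_schouten Gam P base_field base_form j i x) / 2)
    - \sum_(k < 2) v 0 k * (lieGam base_field Gam k i j x
        - (kdelta R i k * base_form j x + kdelta R j k * base_form i x)) = 0.
  pose y : 'rV[R]_(2 + 2) := row_mx x v.
  have xE : xpart y = x by apply/rowP => m; rewrite mxE row_mxEl.
  have vE m : xipart y m = v 0 m by rewrite /xipart row_mxEr.
  have Ty : T y by rewrite /cotU /= xE.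
  have := lie2_metric_lift_xx oU Gam_smooth Gam_sym P_smooth Lam0
    smooth_on_base_field smooth_on_base_form i j Ty.
  rewrite xE; under eq_bigr do rewrite vE.
  move=> <-; rewrite -(X_killing Ty (lx i) (lx j)) /lie2.
  congr (_ + _ + _); apply: eq_bigr => c _.
  - by rewrite killing_liftE.
  - by congr (_ * _); apply/esym/(partial_eq_on _ oT _ Ty) => z; exact: killing_liftE.
  - by congr (_ * _); apply/esym/(partial_eq_on _ oT _ Ty) => z; exact: killing_liftE.
(* The value at [v = 0] removes the constant part, and the [k]-th basis covector then isolates the
   coefficient of xi_k. *)
have := L 0; rewrite big1 ?subr0 => [B0|m _]; last by rewrite mxE mul0r.
have := L (delta_mx 0 k); rewrite B0 sub0r => /eqP; rewrite oppr_eq0 (bigD1 k)//=.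
rewrite big1 ?addr0 => [|m /negPf mk]; last by rewrite mxE mk mul0r.
by rewrite mxE !eqxx mul1r subr_eq0 => /eqP.
Qed.

End Converse.

(** * Correspondence between projective vector fields and Killing fields *)

Unset Implicit Arguments. Set Strict Implicit. Set Printing Implicit Defensive.

Theorem theorem6p3 (R : realType) (U : set 'rV[R]_2)
  (Gam : 'I_2 -> 'I_2 -> 'I_2 -> 'rV[R]_2 -> R)
  (P : 'I_2 -> 'I_2 -> 'rV[R]_2 -> R) (Lam : R) :
  open U ->
  (forall k i j : 'I_2, smooth_on U (Gam k i j)) ->
  (forall (k i j : 'I_2) (x : 'rV[R]_2), U x -> Gam k i j x = Gam k j i x) ->
  is_schouten U Gam P ->
  Lam != 0 ->
  (forall K rho : 'I_2 -> 'rV[R]_2 -> R,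
     projective_vf U Gam K rho ->
     killing (cotU U) (metric_g Gam P Lam) (cot_lift K rho Lam) /\
     (forall y, cotU U y -> forall a b : 'I_(2 + 2),
        lie2 (cot_lift K rho Lam) (omega P Lam) y a b = 0)) /\
  (forall X : 'I_(2 + 2) -> 'rV[R]_(2 + 2) -> R,
     killing (cotU U) (metric_g Gam P Lam) X ->
     exists K rho : 'I_2 -> 'rV[R]_2 -> R,
       projective_vf U Gam K rho /\
       (forall y, cotU U y -> forall a : 'I_(2 + 2), X a y = cot_lift K rho Lam a y)).
Proof.
move=> oU sG Gsym schP Lam0.
have sP := smooth_on_schouten oU sG schP.
split=> [K rho pK|X [sX kX]].
  have [sK KE] := pK; have sr i := projective_rho_smooth oU sG i pK.
  have LS i j x := projective_lie_schouten oU sG Gsym schP i j pK (x := x).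
  split; last first.
    move=> y Ty a b; apply: (lie2_omega_lift Lam oU Gsym sP sK sr a b Ty) => i j.
    exact: LS.
  split=> [a|y Ty]; first exact: (smooth_on_cot_lift Lam oU sK sr a).
  elim/ord22_ind => i; elim/ord22_ind => j.
  - rewrite (lie2_metric_lift_xx oU sG Gsym sP Lam0 sK sr i j Ty) !LS// addr0 mul0r mulr0 sub0r.
    by rewrite big1 ?oppr0// => k _; rewrite KE// subrr mulr0.
  - by rewrite lie2_metric_sym lie2_metric_lift_px.
  - exact: lie2_metric_lift_px.
  - exact: lie2_metric_lift_pp.
exists (base_field X), (base_form Lam X); split.
  exact: (base_projective oU sG Gsym sP Lam0 sX kX).
by move=> y Ty a; exact: (killing_liftE oU Lam0 sX kX a Ty).
Qed.
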